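(* Let $(b_j^k)_{1\le k\le j}$ be the family of polynomials in $\mathbb{Z}[q]$ determined by $b_j^j=1$ for $j\ge 1$, $b_j^1=(1-q^2)\cdots(1-q^j)$ for $j\ge 2$, and $b_j^k=b_{j-1}^{k-1}+(1-q^j)\,b_{j-1}^k-b_{j-2}^{k-1}$ for $2\le k\le j-1$. Then for every integer $n\ge 1$ the Poincaré polynomial $a_n=a_n(q)$ of the set of fully commutative elements of the Coxeter group $W(A_n)$ satisfies $$ q^{n+2}a_n = q^2+\cdots+q^{n+2} + \sum_{i=1}^{n}(q^2+\cdots+q^{i+1})\sum_{s=0}^{n-i}(-1)^{s+1}\sum_{n+1=v_0>v_1>\cdots>v_s>v_{s+1}=i}\ \prod_{u=0}^{s} b_{v_u}^{v_{u+1}}, $$ where the innermost sum runs over all strictly decreasing sequences of integers $(v_0,v_1,\dots,v_{s+1})$ with $v_0=n+1$ and $v_{s+1}=i$.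
   Context: For a positive integer $n$, $W(A_n)$ is the Coxeter group with generators $\sigma_1,\dots,\sigma_n$ and relations $\sigma_i^2=1$, $\sigma_i\sigma_{i+1}\sigma_i=\sigma_{i+1}\sigma_i\sigma_{i+1}$ for $1\le i\le n-1$, and $\sigma_i\sigma_j=\sigma_j\sigma_i$ for $|i-j|\ge 2$ (it is isomorphic to the symmetric group on $n+1$ letters); $W(A_0)=1$. The length $l(w)$ is the minimal number of generators in an expression of $w$; expressions of this length are called reduced. An element $w$ is fully commutative if any reduced expression of $w$ can be obtained from any other by applying only commutation relations $\sigma_i\sigma_j=\sigma_j\sigma_i$, $|i-j|\ge2$. $W^c(A_n)$ denotes the set of fully commutative elements, and its Poincaré polynomial is $a_n=a_n(q)=\sum_{w\in W^c(A_n)}q^{l(w)}\in\mathbb{Z}[q]$, with $a_0=1$. The superscripts in $b_j^k$ are indices, not exponents. *)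

(* Defs.v *)
From HB Require Import structures.
From Stdlib Require Import Relation_Operators.
From mathcomp Require Import all_boot all_order all_algebra.
From mathcomp Require Import boolp classical_sets functions cardinality fsbigop.

Set Implicit Arguments.
Unset Strict Implicit.
Unset Printing Implicit Defensive.

Import GRing.Theory.

(* The generators sigma_1, ..., sigma_n are indexed by 'I_n, so that i : 'I_n
   stands for sigma_{i+1}. *)
Definition word (n : nat) := seq 'I_n.

Definition far (n : nat) (i j : 'I_n) : bool := (i.+2 <= j) || (j.+2 <= i).

Inductive comm_rel (n : nat) : word n -> word n -> Prop :=
| CommRel (i j : 'I_n) : far i j -> comm_rel [:: i; j] [:: j; i].

Inductive cox_rel (n : nat) : word n -> word n -> Prop :=
| CoxSquare (i : 'I_n) : cox_rel [:: i; i] [::]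
| CoxBraid (i j : 'I_n) : j = i.+1 :> nat ->
    cox_rel [:: i; j; i] [:: j; i; j]
| CoxComm (u v : word n) : comm_rel u v -> cox_rel u v.

Inductive rewr (n : nat) (R : word n -> word n -> Prop) :
    word n -> word n -> Prop :=
| Rewr (a b u v : word n) : R u v -> rewr R (a ++ u ++ b) (a ++ v ++ b).

Definition comm_eq (n : nat) : word n -> word n -> Prop :=
  clos_refl_sym_trans _ (rewr (@comm_rel n)).

(* Every generator is an involution, so the monoid presented by the Coxeter
   relations is already the group that they present: inverses need not be added
   to the words. *)
Definition cox_eq (n : nat) : word n -> word n -> Prop :=
  clos_refl_sym_trans _ (rewr (@cox_rel n)).

Section CoxeterGroup.
Variable n : nat.
Implicit Types u v : word n.

Lemma cox_eq_cat u u' v v' :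
  cox_eq u u' -> cox_eq v v' -> cox_eq (u ++ v) (u' ++ v').
Proof.
move=> Eu Ev; apply: (@rst_trans _ _ _ (u' ++ v)).
- elim: Eu => [x y [a b s t st]|x|x y _|x y z _ Exy _].
  + by rewrite -!catA; apply: rst_step; apply: Rewr.
  + exact: rst_refl.
  + exact: rst_sym.
  + exact: rst_trans.
- elim: Ev => [x y [a b s t st]|x|x y _|x y z _ Exy _].
  + by rewrite !(catA u'); apply: rst_step; apply: Rewr.
  + exact: rst_refl.
  + exact: rst_sym.
  + exact: rst_trans.
Qed.

Lemma cox_eq_rev u : cox_eq (rev u ++ u) [::].
Proof.
elim: u => [|i u IHu]; first exact: rst_refl.
rewrite rev_cons cat_rcons; apply: rst_trans IHu.
by apply: rst_step; apply: (@Rewr _ _ (rev u) u [:: i; i] [::]); constructor.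
Qed.

Definition cox_eqb u v : bool := `[< cox_eq u v >].

Lemma cox_eqb_refl : reflexive cox_eqb.
Proof. by move=> u; apply/asboolP/rst_refl. Qed.

Lemma cox_eqb_sym : symmetric cox_eqb.
Proof. by move=> u v; apply/asboolP/asboolP => ?; apply: rst_sym. Qed.

Lemma cox_eqb_trans : transitive cox_eqb.
Proof.
by move=> v u w /asboolP uv /asboolP vw; apply/asboolP/(rst_trans _ _ _ _ _ uv).
Qed.

Canonical cox_equiv := EquivRel cox_eqb cox_eqb_refl cox_eqb_sym cox_eqb_trans.

Definition coxA := {eq_quot cox_equiv}%qT.

HB.instance Definition _ := Choice.on coxA.

Definition cox_class u : coxA := (\pi_coxA u)%qT.

Lemma cox_classP u v : cox_class u = cox_class v <-> cox_eq u v.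
Proof.
split; first by move/eqmodP/asboolP.
by move=> Euv; apply/eqmodP/asboolP.
Qed.

Lemma cox_class_repr (x : coxA) : cox_class (repr x) = x.
Proof. exact: reprK. Qed.

Definition cox_one : coxA := cox_class [::].
Definition cox_mul (x y : coxA) : coxA := cox_class (repr x ++ repr y).
Definition cox_inv (x : coxA) : coxA := cox_class (rev (repr x)).

Lemma cox_mul_class u v : cox_mul (cox_class u) (cox_class v) = cox_class (u ++ v).
Proof.
by apply/cox_classP/cox_eq_cat; apply/cox_classP; rewrite cox_class_repr.
Qed.

Lemma cox_mulA : associative cox_mul.
Proof.
move=> x y z; rewrite -(cox_class_repr x) -(cox_class_repr y).
by rewrite -(cox_class_repr z) !cox_mul_class catA.
Qed.

Lemma cox_mul1 : left_id cox_one cox_mul.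
Proof. by move=> x; rewrite -(cox_class_repr x) cox_mul_class. Qed.

Lemma cox_1mul : right_id cox_one cox_mul.
Proof. by move=> x; rewrite -(cox_class_repr x) cox_mul_class cats0. Qed.

Lemma cox_mulV : left_inverse cox_one cox_inv cox_mul.
Proof.
move=> x; rewrite -{2}(cox_class_repr x) cox_mul_class.
exact/cox_classP/cox_eq_rev.
Qed.

Lemma cox_Vmul : right_inverse cox_one cox_inv cox_mul.
Proof.
move=> x; rewrite -{1}(cox_class_repr x) cox_mul_class.
by apply/cox_classP; rewrite -{1}[repr x]revK; apply: cox_eq_rev.
Qed.

HB.instance Definition _ :=
  isGroup.Build coxA cox_mulA cox_mul1 cox_1mul cox_mulV cox_Vmul.

Definition sigma (i : 'I_n) : coxA := cox_class [:: i].

Definition word_val u : coxA := (\prod_(i <- u) sigma i)%g.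

Lemma word_valE u : word_val u = cox_class u.
Proof.
rewrite /word_val; elim: u => [|i u IHu]; first by rewrite big_nil.
by rewrite big_cons IHu; exact: cox_mul_class.
Qed.

Lemma word_valP u v : word_val u = word_val v <-> cox_eq u v.
Proof. by rewrite !word_valE; exact: cox_classP. Qed.

Definition has_expr (w : coxA) (k : nat) : bool :=
  [exists u : k.-tuple 'I_n, word_val u == w].

Lemma has_expr_ex (w : coxA) : exists k, has_expr w k.
Proof.
exists (size (repr w)); apply/existsP; exists (in_tuple (repr w)).
by rewrite word_valE cox_class_repr.
Qed.

Definition cox_length (w : coxA) : nat := ex_minn (has_expr_ex w).

Definition reduced_expr (w : coxA) u : Prop :=
  word_val u = w /\ size u = cox_length w.

Definition fully_commutative (w : coxA) : Prop :=
  forall u v, reduced_expr w u -> reduced_expr w v -> comm_eq u v.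

End CoxeterGroup.

Local Open Scope classical_set_scope.
Local Open Scope ring_scope.

Definition Wc (n : nat) : set (coxA n) := [set w | fully_commutative w].
Arguments Wc n : clear implicits.

(* The sum over a set has the value 0 when infinitely many of its terms are
   nonzero; since 'X^k never vanishes, this would be the value if Wc n were
   infinite. *)
Definition fc_poincare (n : nat) : {poly int} :=
  \sum_(w \in Wc n) ('X^(cox_length w) : {poly int}).

(* b_poly j k is the polynomial b_j^k for 1 <= k <= j; the values at other
   indices are irrelevant. *)
Fixpoint b_poly (j k : nat) {struct j} : {poly int} :=
  if j is j1.+1 then
    if k == j then 1
    else if k == 1%N then \prod_(2 <= m < j.+1) (1 - 'X^m)
    else if j1 is j2.+1 then
      b_poly j1 k.-1 + (1 - 'X^j) * b_poly j1 k - b_poly j2 k.-1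
    else 0
  else 0.

Lemma b_poly_diag j : (1 <= j)%N -> b_poly j j = 1.
Proof. by case: j => //= j _; rewrite eqxx. Qed.

Lemma b_poly_1 j : (2 <= j)%N -> b_poly j 1 = \prod_(2 <= m < j.+1) (1 - 'X^m).
Proof. by case: j => [|[|j]]. Qed.

Lemma b_poly_rec j k : (2 <= k <= j.-1)%N ->
  b_poly j k = b_poly j.-1 k.-1 + (1 - 'X^j) * b_poly j.-1 k - b_poly j.-2 k.-1.
Proof.
case: j => [|[|j]]; case: k => [|[|k]] //= lt_kj.
by case: eqP => // ek; move: lt_kj; rewrite ek ltnn.
Qed.

Definition descending_from_to (a i : nat) (v : seq nat) : bool :=
  [&& head 0%N v == a, last 0%N v == i & sorted gtn v].

(* The sequences (v_0, ..., v_{s+1}) that strictly decrease from a to i have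
   entries at most a, so tuples over 'I_a.+1 account for all of them. *)
Definition chain_sum (a i s : nat) : {poly int} :=
  \sum_(v : s.+2.-tuple 'I_a.+1 | descending_from_to a i (map val v))
    \prod_(0 <= u < s.+1)
      b_poly (nth 0%N (map val v) u) (nth 0%N (map val v) u.+1).

(* Main.v *)
Require Import Defs.
From Stdlib Require Import Relation_Operators.
From mathcomp Require Import all_boot all_order all_algebra.
From mathcomp Require Import boolp classical_sets fsbigop.
From mathcomp Require Import zify ring.

(** Write a_m for the Poincare polynomial of the fully commutative elements of
W(A_m), A_k for q^(k+1) a_(k-1) and S_j for q^2 + ... + q^(j+1).  The matrix
(b_j^k) is lower unitriangular, and the alternating sum over the decreasing
sequences from n+1 to i of the products of its entries is the entry (n+1, i) of
its inverse.  So the formula for a_n is the solution of the triangular system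
 sum over k <= j of b_j^k A_k = S_j, for all j ([b_poly_scaled_normal_poly]);
the inversion is [invert_unitriangular].

To evaluate the left-hand side, the fully commutative elements are parametrized
by normal words: concatenations of descending runs whose first letters increase
strictly and whose last letters increase strictly.  Every word becomes a normal
word by commutations, unless commutations bring out a factor ii or iji with i
and j adjacent ([normal_insert]).  A fully commutative element admits no such
factor in its reduced words, hence is given by a normal word.

For the converse no theorem on braid moves between reduced words is used, but
the total excess, sum of max(f p - p, 0), of the permutation f of an element.
It is subadditive, at most 1 on a generator, and at most 2 on iji; so it is a
lower bound of the length, and a word that commutations bring to a form with a
factor ii or iji has excess smaller than its size.  The excess of a normal word
is its size: each run moves up one point, by the size of the run, and the other
points do not move up.  Hence normal words are reduced, all reduced words of the element
that they define are equivalent to a normal word, and this normal word is the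
same since the permutation determines it ([normal_fc], [act_normal_inj]).

Let g(N, d) count by length the normal words with letters below N and all runs
ending below d (letters are numbered from 0); then a_m = g(m, m).  Removing the
last run gives
  g(N, d+1) = g(N, d) + sum over t < N - d of q^(t+1) g(d+t, d).
This is what is needed to prove, by induction on j with the recurrence of b,
the stronger identity
  sum over k <= j of b_j^k A_(k+d) = q^(d+2) (sum over t < j of q^t g(d+t, d))
([weighted_rowE]), whose case d = 0 is the system above, as g(t, 0) = 1. *)

Set Implicit Arguments.
Unset Strict Implicit.
Unset Printing Implicit Defensive.

Import GRing.Theory.

(** * Normal words *)

Definition block (d t : nat) : seq nat := rev (iota d t.+1).

(** Words with letters below N, every run of which ends below d.  The recursion
fixes the last run [block d1 t]; as first and last letters of the runs both
increase strictly, what precedes it has letters below d1 + t and runs ending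
below d1. *)
Fixpoint normal_words (N d : nat) : seq (seq nat) :=
  if d is d1.+1 then
    normal_words N d1 ++
      [seq w ++ block d1 t | t <- iota 0 (N - d1), w <- normal_words (d1 + t) d1]
  else [:: [::]].

Variant normal_words_spec (N d : nat) (w : seq nat) : Prop :=
| NormalOld of w \in normal_words N d
| NormalBlock t w1 of t < N - d & w1 \in normal_words (d + t) d
    & w = w1 ++ block d t.

Lemma normal_wordsS N d w :
  w \in normal_words N d.+1 <-> normal_words_spec N d w.
Proof.
rewrite /= mem_cat; split.
  case/orP=> [|/allpairsPdep[t [w1 []]]]; first by left.
  by rewrite mem_iota => /= lt_t w1P ->; right with t w1.
case=> [->//|t w1 lt_t w1P ->]; apply/orP; right.
by apply/allpairsPdep; exists t, w1; rewrite mem_iota.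
Qed.

Lemma normal_words_sub N d e w :
  d <= e -> w \in normal_words N d -> w \in normal_words N e.
Proof.
by move/subnKC<-; elim: (e - d) => [|m IHm] wP;
  rewrite ?addn0 // addnS /= mem_cat IHm.
Qed.

Lemma normal_words_lt N d w : w \in normal_words N d -> all (gtn N) w.
Proof.
elim: d N w => [|d IHd] N w; first by rewrite inE => /eqP->.
case/normal_wordsS=> [/IHd//|t w1 lt_t /IHd/allP lt_w1 ->].
apply/allP=> k; rewrite mem_cat mem_rev mem_iota => /orP[/lt_w1|] /=; lia.
Qed.

Lemma size_block d t : size (block d t) = t.+1.
Proof. by rewrite size_rev size_iota. Qed.

(** * Words up to commutation *)

Section Commutation.
Variable n : nat.
Implicit Types u v x y : word n.

Lemma comm_eq_ctx x y u v : comm_eq u v -> comm_eq (x ++ u ++ y) (x ++ v ++ y).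
Proof.
elim=> [_ _ [a b s t st]|s|s t _|s t r _ Est _].
- rewrite -!catA !(catA x); exact/rst_step/Rewr.
- exact: rst_refl.
- exact: rst_sym.
- exact: rst_trans.
Qed.

Lemma comm_eq_cox u v : comm_eq u v -> cox_eq u v.
Proof.
elim=> [_ _ [a b s t st]|s|s t _|s t r _ Est _].
- exact/rst_step/Rewr/CoxComm.
- exact: rst_refl.
- exact: rst_sym.
- exact: rst_trans.
Qed.

Lemma comm_eq_perm u v : comm_eq u v -> perm_eq u v.
Proof.
elim=> [_ _ [a b _ _ [i j _]]|s //|s t _|s t r _ Est _].
- by rewrite perm_cat2l perm_cat2r (perm_catC [:: i] [:: j]).
- by rewrite perm_sym.
- exact: perm_trans.
Qed.

(** Normal words are written with natural numbers, so that they do not depend on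
the rank; a letter that is not below n is discarded, which keeps the
translation multiplicative without any side condition. *)
Definition word_of (u : seq nat) : word n := pmap insub u.

Lemma word_of_cat s t : word_of (s ++ t) = word_of s ++ word_of t.
Proof. exact: pmap_cat. Qed.

Lemma word_ofK s : all (gtn n) s -> map val (word_of s) = s.
Proof.
by elim: s => //= k s IHs /andP[lt_kn /IHs]; rewrite /word_of /= insubT /= => ->.
Qed.

Lemma word_of_ctx (x y s t : seq nat) :
  comm_eq (word_of s) (word_of t) ->
  comm_eq (word_of (x ++ s ++ y)) (word_of (x ++ t ++ y)).
Proof. by rewrite !word_of_cat; apply: comm_eq_ctx. Qed.

Lemma word_of_swap m k : (k.+2 <= m) || (m.+2 <= k) ->
  comm_eq (word_of [:: m; k]) (word_of [:: k; m]).
Proof.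
move=> far_mk; rewrite /word_of /=.
case: insubP => [j _ def_j|_]; last exact: rst_refl.
case: insubP => [i _ def_i|_]; last exact: rst_refl.
rewrite /=; apply: rst_step.
apply: (@Rewr _ _ [::] [::] [:: i; j] [:: j; i]).
by constructor; rewrite /far def_i def_j orbC.
Qed.

Lemma word_of_comm k s : {in s, forall m, (k.+2 <= m) || (m.+2 <= k)} ->
  comm_eq (word_of (s ++ [:: k])) (word_of (k :: s)).
Proof.
elim: s => [|m s IHs] far_s; first exact: rst_refl.
apply: (@rst_trans _ _ _ (word_of [:: m, k & s])).
  have := @word_of_ctx [:: m] [::] (s ++ [:: k]) (k :: s); rewrite !cats0.
  by apply; apply: IHs => p sp; apply: far_s; rewrite inE sp orbT.
apply: (@word_of_ctx [::] s [:: m; k] [:: k; m]).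
exact/word_of_swap/far_s/mem_head.
Qed.

(** The factors excluded from all words commutation-equivalent to a reduced word
of a fully commutative element. *)
Variant short_braid : word n -> Prop :=
| ShortSquare i : short_braid [:: i; i]
| ShortBraid (i j : 'I_n) : j = i.+1 :> nat \/ i = j.+1 :> nat ->
    short_braid [:: i; j; i].

Definition braided u : Prop :=
  exists x p y, short_braid p /\ comm_eq u (x ++ p ++ y).

Lemma braided_ctx x y u : braided u -> braided (x ++ u ++ y).
Proof.
case=> x1 [p [y1 [pP Eu]]]; exists (x ++ x1), p, (y1 ++ y); split=> //.
by have := comm_eq_ctx x y Eu; rewrite -!catA.
Qed.

Lemma braided_comm u v : comm_eq u v -> braided u -> braided v.
Proof.
move=> Euv [x [p [y [pP Eu]]]]; exists x, p, y; split=> //.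
exact: rst_trans (rst_sym _ _ _ _ Euv) Eu.
Qed.

Lemma braided_square k s t : k < n -> braided (word_of (s ++ [:: k; k] ++ t)).
Proof.
move=> lt_kn; exists (word_of s), (word_of [:: k; k]), (word_of t).
rewrite -!word_of_cat; split; last exact: rst_refl.
by rewrite /word_of /= insubT /=; constructor.
Qed.

Lemma braided_braid k m s t : k < n -> m < n -> m = k.+1 \/ k = m.+1 ->
  braided (word_of (s ++ [:: k; m; k] ++ t)).
Proof.
move=> lt_kn lt_mn adj; exists (word_of s), (word_of [:: k; m; k]), (word_of t).
rewrite -!word_of_cat; split; last exact: rst_refl.
by rewrite /word_of /= !insubT /=; constructor.
Qed.

(** The last run is [block d t], from d + t down to d.  The letter k starts a
new run if k > d + t; creates a square if k = d; commutes past the smaller end of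
the run and forms a braid k, k-1, k if d < k <= d + t; and commutes with the
whole run, hence is inserted in what precedes, if k + 1 < d.  If k + 1 = d it
extends the run, unless the run before also ends with k, and then k, k+1, k
appears.  The bound maxn d k.+1 on the ends of the runs is what the induction
needs to put the last run back. *)
Lemma normal_insert N d w k : N <= n -> w \in normal_words N d -> k < N ->
  braided (word_of (w ++ [:: k])) \/
  exists2 w', w' \in normal_words N (maxn d k.+1)
            & comm_eq (word_of (w ++ [:: k])) (word_of w').
Proof.
elim: d N w k => [|d IHd] N w k leNn wP lt_kN.
  right; exists [:: k].
    apply: (@normal_words_sub _ k.+1); first by rewrite leq_maxr.
    apply/normal_wordsS; right with 0 [::]; rewrite ?subn_gt0 //.
    by apply: (@normal_words_sub _ 0) => //; rewrite mem_seq1.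
  move: wP; rewrite inE => /eqP->; exact: rst_refl.
case/normal_wordsS: wP => [wP|t w1 lt_t w1P def_w].
  have [|[w' w'P Ew']] := IHd N w k leNn wP lt_kN; [by left | right].
  by exists w' => //; apply: normal_words_sub w'P; lia.
have [lt_dt_k | le_k_dt] := ltnP (d + t) k.
  right; exists (w ++ [:: k]); last exact: rst_refl.
  apply: (@normal_words_sub _ k.+1); first by rewrite leq_maxr.
  apply/normal_wordsS; right with 0 w; rewrite ?subn_gt0 ?addn0 //.
  apply: (@normal_words_sub _ d.+1); first lia.
  by apply/normal_wordsS; right with t w1; first lia.
rewrite def_w; have [k_lt_d|d_lt_k|->] := ltngtP k d.
- have [k1_lt_d|] := ltnP k.+1 d.
    have Ek : comm_eq (word_of ((w1 ++ block d t) ++ [:: k]))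
                      (word_of ((w1 ++ [:: k]) ++ block d t)).
      rewrite -[in X in comm_eq X]catA -[in X in comm_eq _ X]catA.
      have := @word_of_ctx w1 [::] (block d t ++ [:: k]) (k :: block d t).
      rewrite !cats0; apply; apply: word_of_comm => m.
      by rewrite mem_rev mem_iota; lia.
    have [| |bad|[w' w'P Ew']] := IHd (d + t) w1 k _ w1P; [lia|lia| |].
      left; apply: (braided_comm (rst_sym _ _ _ _ Ek)).
      by have := braided_ctx [::] (word_of (block d t)) bad; rewrite -word_of_cat.
    right; exists (w' ++ block d t).
      apply: (@normal_words_sub _ d.+1); first lia.
      apply/normal_wordsS; right with t w' => //.
      by move: w'P; rewrite (maxn_idPl _).
    exact/(rst_trans _ _ _ _ _ Ek)/(@word_of_ctx [::]).
  move=> d_le_k1; have {d_le_k1 k_lt_d} def_d: d = k.+1 by lia.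
  clear IHd; subst d.
  case/normal_wordsS: w1P => [w1P|t2 w2 lt_t2 w2P ->].
    right; exists (w1 ++ block k t.+1).
      apply: (@normal_words_sub _ k.+1); first lia.
      by apply/normal_wordsS; right with t.+1 w1; rewrite ?addnS //; lia.
    by rewrite -catA [block k.+1 t ++ _]cats1 -rev_cons; apply: rst_refl.
  left; apply: (@braided_comm (word_of
    ((w2 ++ rev (iota k.+1 t2) ++ rev (iota k.+2 t)) ++ [:: k; k.+1; k] ++ [::]))).
    apply: rst_sym; rewrite /block /= !rev_cons -!cats1 -!catA.
    have := @word_of_ctx (w2 ++ rev (iota k.+1 t2)) [:: k.+1; k]
       (rev (iota k.+2 t) ++ [:: k]) (k :: rev (iota k.+2 t)).
    rewrite -!catA /= => E; apply: rst_sym; apply: E; apply: word_of_comm => m.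
    by rewrite mem_rev mem_iota; lia.
  by apply: braided_braid; [lia|lia|left].
- left; pose a := k.-1 - d; pose b := d + t - k.
  have def_block : block d t = rev (iota k.+1 b) ++ [:: k; k.-1] ++ rev (iota d a).
    rewrite /block (_ : t.+1 = a + (2 + b)); last by rewrite /a /b; lia.
    rewrite !iotaD !rev_cat (_ : d + a = k.-1); last by rewrite /a; lia.
    have k1 : k.-1.+1 = k by lia.
    by rewrite addn2 /rev /= k1 -catA.
  apply: (@braided_comm (word_of
    ((w1 ++ rev (iota k.+1 b)) ++ [:: k; k.-1; k] ++ rev (iota d a)))).
    rewrite def_block -!catA; apply: rst_sym.
    have := @word_of_ctx (w1 ++ rev (iota k.+1 b) ++ [:: k; k.-1]) [::]
       (rev (iota d a) ++ [:: k]) (k :: rev (iota d a)).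
    rewrite !cats0 -!catA /=; apply; apply: word_of_comm => m.
    by rewrite mem_rev mem_iota /a; lia.
  by apply: braided_braid; [lia|lia|right; lia].
- left; rewrite /block /= rev_cons -cats1 -!catA catA.
  by apply: (@braided_square _ _ [::]); lia.
Qed.
End Commutation.

(** * The action on integers and the total excess *)

Definition swap (i p : nat) : nat :=
  if p == i then i.+1 else if p == i.+1 then i else p.

(** The permutation defined by a word, with generator i exchanging i and i + 1.
It acts on all natural numbers, independently of the rank. *)
Definition act (s : seq nat) (p : nat) : nat := foldr swap p s.

Lemma swapK i : involutive (swap i).
Proof. by move=> p; rewrite /swap; do !case: eqP; lia. Qed.

Lemma act_cat s t p : act (s ++ t) p = act s (act t p).
Proof. by rewrite /act foldr_cat. Qed.

Lemma act_braid i p : act [:: i; i.+1; i] p = act [:: i.+1; i; i.+1] p.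
Proof. by rewrite /act /= /swap; do !case: eqP; lia. Qed.

Lemma act_cox n (u v : word n) : cox_eq u v -> act (map val u) =1 act (map val v).
Proof.
elim=> [_ _ [a b x y xy]|//|s t _ IH p|s t r _ IHst _ IHtr p]; last first.
- by rewrite IHst IHtr.
- by rewrite IH.
move=> p; rewrite !map_cat !act_cat; congr act; move: (act _ p) => {}p.
case: xy => [i|i j def_j|_ _ [i j far_ij]] /=.
- by rewrite /act /= swapK.
- by rewrite def_j; apply: act_braid.
- by move: far_ij; rewrite /far /act /= /swap; do !case: eqP; lia.
Qed.

Lemma act_id M s p : all (gtn M) s -> M < p -> act s p = p.
Proof.
move=> + lt_Mp; elim: s => //= i s IHs /andP[lt_iM /IHs].
by rewrite /act /= => ->; rewrite /swap; do !case: eqP; lia.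
Qed.

Lemma act_block d t p :
  act (block d t) p =
    if p == d then (d + t).+1 else if d < p <= (d + t).+1 then p.-1 else p.
Proof.
elim: t p => [|t IHt] p.
  by rewrite /act /block /= /swap addn0; do ![case: eqP | case: ifP]; lia.
rewrite /block -addn1 iotaD rev_cat act_cat -/(block d t) IHt /act /= /swap.
by do ![case: eqP | case: ifP]; lia.
Qed.

(** The last run sends d to d + t + 1, which the letters before it fix. *)
Lemma act_normal_block d t w p : w \in normal_words (d + t) d ->
  act (w ++ block d t) p =
    if p == d then (d + t).+1
    else if d < p <= (d + t).+1 then act w p.-1 else act w p.
Proof.
move=> /normal_words_lt wlt; rewrite act_cat act_block.
by do 2?case: ifP => // _; apply: act_id wlt _.
Qed.

(** Only the points where a run ends are moved up, and they are below d. *)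
Lemma act_normal_le N d w p : w \in normal_words N d -> d <= p -> act w p <= p.
Proof.
elim: d N w p => [|d IHd] N w p; first by rewrite mem_seq1 => /eqP->.
case/normal_wordsS=> [/IHd IH|t w1 _ w1P ->] le_dp; first exact/IH/ltnW.
rewrite act_normal_block //; case: eqP => [|_]; first lia.
case: ifP => [_|_]; last by apply: IHd w1P _; lia.
by apply: leq_trans (leq_pred p); apply: IHd w1P _; lia.
Qed.

(** The last run can be read off the image of d, by [act_normal_block] and
[act_normal_le]; cancelling it reduces to shorter words. *)
Lemma act_normal_inj N d w w' : w \in normal_words N d ->
  w' \in normal_words N d -> act w =1 act w' -> w = w'.
Proof.
elim: d N w w' => [|d IHd] N w w'; first by rewrite !mem_seq1 => /eqP-> /eqP->.
case/normal_wordsS=> [wP|t w1 _ w1P ->]; case/normal_wordsS=> [w'P|t' w1' _ w1'P ->] Ew.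
- exact: (IHd N _ _ wP w'P Ew).
- have := act_normal_le wP (leqnn d); rewrite Ew act_normal_block // eqxx; lia.
- have := act_normal_le w'P (leqnn d); rewrite -Ew act_normal_block // eqxx; lia.
have Et : t = t'.
  by have := Ew d; rewrite !act_normal_block // eqxx; lia.
rewrite -{t'}Et in w1'P Ew *; congr (_ ++ _); apply: (IHd (d + t)) => // p.
(* The last run acts as a permutation: r is the point that it sends to p. *)
pose r := if p == (d + t).+1 then d else if d <= p <= d + t then p.+1 else p.
have act_r : act (block d t) r = p.
  by rewrite act_block /r; do ![case: eqP | case: ifP]; lia.
by rewrite -act_r -!act_cat.
Qed.

Section Excess.
Variable n : nat.

(** A substitute for the number of inversions: half of the total displacement,
when f permutes the integers up to n. *)
Definition excess (f : nat -> nat) : nat := \sum_(p < n.+1) (f p - p).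

Lemma eq_excess f g : f =1 g -> excess f = excess g.
Proof. by move=> fg; apply: eq_bigr => p _; rewrite fg. Qed.

Lemma sum_act (F : nat -> nat) s : all (gtn n) s ->
  \sum_(p < n.+1) F (act s p) = \sum_(p < n.+1) F p.
Proof.
elim/last_ind: s => // s i IHs; rewrite all_rcons => /andP[lt_in /IHs {IHs}<-].
have swap_lt (p : 'I_n.+1) : swap i p < n.+1.
  by have := ltn_ord p; rewrite /swap /= in lt_in *; do !case: eqP; lia.
rewrite [RHS](reindex_inj (h := fun p => Ordinal (swap_lt p))).
  by apply: eq_bigr => p _; rewrite -cats1 act_cat.
by move=> p q [] /(can_inj (@swapK i)) /val_inj.
Qed.

(** By the triangle inequality for positive parts, after reindexing the first
term along the permutation of t. *)
Lemma excess_cat s t : all (gtn n) t ->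
  excess (act (s ++ t)) <= excess (act s) + excess (act t).
Proof.
move=> lt_t; rewrite /excess -(@sum_act (fun p => act s p - p) t) // -big_split.
by apply: leq_sum => p _; rewrite act_cat /=; lia.
Qed.

Lemma excess1 i : excess (act [:: i]) <= 1.
Proof.
rewrite /excess; have [lt_in | le_ni] := ltnP i n.+1; last first.
  by rewrite big1 // => p _; have := ltn_ord p; rewrite /act /= /swap; do !case: eqP; lia.
rewrite (bigD1 (Ordinal lt_in)) //= big1 => [|p]; rewrite /act /= /swap ?eqxx; first lia.
by rewrite -val_eqE /=; do !case: eqP; lia.
Qed.

Lemma excess_size s : all (gtn n) s -> excess (act s) <= size s.
Proof.
elim/last_ind: s => [|s i IHs]; first by rewrite /excess big1 // => p _; rewrite subnn.
rewrite all_rcons => /andP[lt_in /IHs le_s]; rewrite -cats1 size_cat.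
apply: leq_trans (excess_cat _ _) _; first by rewrite /= andbT.
exact: leq_add le_s (excess1 i).
Qed.

(** A square acts as the identity, and i, i+1, i exchanges i and i+2. *)
Lemma excess_short (p : word n) : short_braid p -> excess (act (map val p)) < size p.
Proof.
have braid i : excess (act [:: i; i.+1; i]) < 3.
  rewrite /excess; have [lt_in | le_ni] := ltnP i n.+1; last first.
    by rewrite big1 // => q _; have := ltn_ord q; rewrite /act /= /swap; do !case: eqP; lia.
  rewrite (bigD1 (Ordinal lt_in)) //= big1 => [|q].
    by rewrite /act /= /swap; do !case: eqP; lia.
  by rewrite -val_eqE /act /= /swap /=; do !case: eqP; lia.
case=> [i|i j [adj|adj]] /=; rewrite ?adj.
- by rewrite /excess big1 // => q _; rewrite /act /= swapK subnn.
- exact: braid.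
- by rewrite -(eq_excess (act_braid j)); apply: braid.
Qed.

Lemma excess_braided (u : word n) : braided u -> excess (act (map val u)) < size u.
Proof.
case=> x [p [y [/excess_short lt_p Eu]]].
have all_lt (s : word n) : all (gtn n) (map val s).
  by apply/allP=> _ /mapP[i _ ->]; apply: ltn_ord.
rewrite (eq_excess (act_cox (comm_eq_cox Eu))) (perm_size (comm_eq_perm Eu)).
rewrite !map_cat !size_cat.
apply: leq_ltn_trans (excess_cat _ _) _; first by rewrite all_cat !all_lt.
apply: leq_ltn_trans (leq_add (excess_size (all_lt x)) (leqnn _)) _.
rewrite size_map ltn_add2l; apply: leq_ltn_trans (excess_cat _ (all_lt y)) _.
apply: leq_ltn_trans (leq_add (leqnn _) (excess_size (all_lt y))) _.
by rewrite size_map ltn_add2r.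
Qed.

(** Adding the run [block d t] creates the excedance d of excess t + 1, and only
moves values that are not excedances among the points beyond d. *)
Lemma excess_normal N d w : N <= n -> w \in normal_words N d ->
  excess (act w) = size w.
Proof.
elim: d N w => [|d IHd] N w leNn.
  by rewrite mem_seq1 => /eqP->; rewrite /excess big1 // => p _; rewrite subnn.
case/normal_wordsS=> [/(IHd _ _ leNn)//|t w1 lt_t w1P ->].
have lt_dn : d < n.+1 by lia.
have dt_n : d + t <= n by lia.
rewrite size_cat size_block -(IHd _ _ dt_n w1P) /excess.
rewrite (bigD1 (Ordinal lt_dn)) //= [in RHS](bigD1 (Ordinal lt_dn)) //=.
rewrite act_normal_block // eqxx.
have /eqP-> : act w1 d - d == 0 by rewrite subn_eq0 (act_normal_le w1P).
rewrite add0n addnC; congr (_ + _); last lia.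
apply: eq_bigr => p; rewrite -val_eqE /= => ne_pd.
rewrite act_normal_block // (negPf ne_pd); case: ifP => // dp.
have := @act_normal_le _ _ _ p.-1 w1P; have := @act_normal_le _ _ _ p w1P; lia.
Qed.

End Excess.

(** * Fully commutative elements are the normal words *)

Section FullyCommutative.
Variable n : nat.
Implicit Types (u : word n) (v : seq nat).

Lemma all_val_lt u : all (gtn n) (map val u).
Proof. by apply/allP=> _ /mapP[i _ ->]; apply: ltn_ord. Qed.

Lemma cox_length_le u : cox_length (word_val u) <= size u.
Proof.
rewrite /cox_length; case: ex_minnP => k _; apply.
by apply/existsP; exists (in_tuple u).
Qed.

Lemma reduced_exists (w : coxA n) : exists u, reduced_expr w u.
Proof.
rewrite /reduced_expr /cox_length; case: ex_minnP => k /existsP[u /eqP def_w] _.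
by exists u; rewrite size_tuple.
Qed.

Lemma normal_of_unbraided u : ~ braided u ->
  exists2 v, v \in normal_words n n & comm_eq u (word_of n v).
Proof.
elim/last_ind: u => [|u i IHu] nbr.
  by exists [::]; [apply: (@normal_words_sub _ 0); rewrite ?mem_seq1 | apply: rst_refl].
have [|v vP Euv] := IHu.
  by move=> /(braided_ctx [::] [:: i]); rewrite /= cats1.
have Eui : comm_eq (rcons u i) (word_of n (v ++ [:: val i])).
  rewrite -cats1 word_of_cat (_ : word_of n [:: val i] = [:: i]).
    exact: (comm_eq_ctx [::]).
  by rewrite /word_of /= valK.
have [bad|[v' v'P Ev']] := normal_insert (leqnn n) vP (ltn_ord i).
  by case: nbr; apply: braided_comm bad; apply: rst_sym.
exists v'; last exact: rst_trans Eui Ev'.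
by rewrite (maxn_idPl (ltn_ord i)) in v'P.
Qed.

Lemma size_word_of v : v \in normal_words n n -> size (word_of n v) = size v.
Proof. by move/normal_words_lt/word_ofK=> E; rewrite -[RHS](congr1 size E) size_map. Qed.

(** The excess of a normal word bounds from below the size of every word of the
same element. *)
Lemma normal_length v : v \in normal_words n n ->
  cox_length (word_val (word_of n v)) = size v.
Proof.
move=> vP; apply/eqP; rewrite eqn_leq -{1}(size_word_of vP) cox_length_le /=.
have [u [/word_valP/act_cox Eu <-]] := reduced_exists (word_val (word_of n v)).
rewrite -(excess_normal (leqnn n) vP) -(word_ofK (normal_words_lt vP)).
by rewrite -(eq_excess n Eu) -(size_map val u) excess_size ?all_val_lt.
Qed.

Lemma normal_val_inj : {in normal_words n n &, injective (fun v => word_val (word_of n v))}.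
Proof.
move=> v v' vP v'P /word_valP/act_cox; rewrite !word_ofK ?(@normal_words_lt n n) //.
exact: (act_normal_inj vP v'P).
Qed.

(** In a reduced word of the element the excess equals the size, so no short
braid can appear: it is equivalent to a normal word, which has the same
permutation. *)
Lemma normal_fc v : v \in normal_words n n ->
  fully_commutative (word_val (word_of n v)).
Proof.
move=> vP; suff to_v u : reduced_expr (word_val (word_of n v)) u ->
    comm_eq u (word_of n v).
  by move=> u u' /to_v Eu /to_v Eu'; apply: rst_trans Eu (rst_sym _ _ _ _ Eu').
case=> Eu size_u; have [|v' v'P Ev'] := @normal_of_unbraided u.
  move/excess_braided; rewrite size_u normal_length //.
  rewrite (eq_excess n (act_cox (proj1 (word_valP _ _) Eu))).
  by rewrite word_ofK ?(normal_words_lt vP) // (excess_normal (leqnn n) vP) ltnn.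
rewrite (@normal_val_inj v v') // -Eu; apply/word_valP/comm_eq_cox.
exact: Ev'.
Qed.

(** A square would contradict minimality of the length.  Applying the braid
relation to a factor iji gives another reduced word with fewer letters i, which
commutations cannot achieve. *)
Lemma fc_normal (w : coxA n) : fully_commutative w ->
  exists2 v, v \in normal_words n n & word_val (word_of n v) = w.
Proof.
move=> fc_w; have [u red_u] := reduced_exists w; have [def_w size_u] := red_u.
have [|v vP /comm_eq_cox/word_valP Ev] := @normal_of_unbraided u; last by exists v; rewrite // -Ev.
case=> x [p [y [pP Eu]]].
have def_w' : word_val (x ++ p ++ y) = w.
  by rewrite -def_w; apply/word_valP/rst_sym/comm_eq_cox.
have size_u' : size (x ++ p ++ y) = cox_length w.
  by rewrite -size_u (perm_size (comm_eq_perm Eu)).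
case: pP def_w' size_u' {Eu} => [i|i j adj] def_w' size_u'.
  have : cox_length w <= size (x ++ y).
    rewrite -def_w' (_ : word_val _ = word_val (x ++ y)); first exact: cox_length_le.
    by apply/word_valP/rst_step; apply: (Rewr x y (CoxSquare i)).
  by rewrite -size_u' !size_cat /=; lia.
have Eij : cox_eq (x ++ [:: i; j; i] ++ y) (x ++ [:: j; i; j] ++ y).
  case: adj => adj; first by apply/rst_step/(Rewr x y (CoxBraid adj)).
  exact/rst_sym/rst_step/(Rewr x y (CoxBraid adj)).
have red_iji : reduced_expr w (x ++ [:: i; j; i] ++ y) by [].
have red_jij : reduced_expr w (x ++ [:: j; i; j] ++ y).
  split; first by rewrite -def_w'; apply/esym/word_valP.
  by rewrite -size_u' !size_cat.
move: (fc_w _ _ red_iji red_jij).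
move/comm_eq_perm/permP/(_ (pred1 i)); rewrite !count_cat /= !eqxx.
have -> : (j == i) = false by apply/negP => /eqP E; rewrite E in adj; lia.
lia.
Qed.

Lemma uniq_normal_words N d : uniq (normal_words N d).
Proof.
elim: d N => // d IHd N; rewrite [normal_words _ _]/= cat_uniq IHd /=.
apply/andP; split.
  apply/hasPn=> _ /allpairsPdep[t [w [_ wP ->]]]; apply/negP=> /act_normal_le.
  by move/(_ _ (leqnn d)); rewrite act_normal_block // eqxx; lia.
apply: allpairs_uniq_dep; [exact: iota_uniq | by move=> t _; apply: IHd |].
move=> _ _ /allpairsPdep[t [w [_ wP ->]]] /allpairsPdep[t' [w' [_ w'P ->]]] /= E.
have Et : t = t'.
  by have := congr1 (act ^~ d) E; rewrite !act_normal_block // eqxx; lia.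
rewrite -{t'}Et in E w'P *; move/(congr1 rev)/eqP: E.
by rewrite !rev_cat eqseq_cat // eqxx => /eqP/(can_inj revK)->.
Qed.

End FullyCommutative.

(** * Generating polynomials of normal words *)

Local Open Scope ring_scope.

Definition normal_poly (N d : nat) : {poly int} :=
  \sum_(w <- normal_words N d) 'X^(size w).

Lemma normal_poly0 N : normal_poly N 0 = 1.
Proof. by rewrite /normal_poly /= big_seq1 expr0. Qed.

Lemma normal_polyS N d :
  normal_poly N d.+1 =
    normal_poly N d + \sum_(0 <= t < N - d) 'X^(t.+1) * normal_poly (d + t) d.
Proof.
rewrite /normal_poly /= big_cat /=; congr (_ + _).
rewrite big_allpairs_dep /index_iota subn0; apply: eq_bigr => t _.
rewrite big_distrr /=; apply: eq_bigr => w _.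
by rewrite size_cat size_block addnC exprD.
Qed.


Lemma fc_poincare_normal n : fc_poincare n = normal_poly n n.
Proof.
rewrite /fc_poincare /normal_poly.
have -> : Wc n = [set` [seq word_val (word_of n v) | v <- normal_words n n]]%classic.
  apply/seteqP; split=> w /=.
    by move=> /fc_normal[v vP <-]; apply: (map_f (fun v => word_val (word_of n v))).
  by move=> /mapP[v vP ->]; apply: normal_fc.
rewrite -fsbig_seq; last first.
  by rewrite map_inj_in_uniq ?uniq_normal_words //; apply: normal_val_inj.
by rewrite big_map; apply: eq_big_seq => v vP; rewrite normal_length.
Qed.

(** * The triangular system with coefficients b *)

Lemma b_poly0 j : b_poly j 0 = 0.
Proof.
suff: b_poly j 0 = 0 /\ b_poly j.+1 0 = 0 by case.
elim: j => [//|j [IH0 IH1]]; split=> //.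
have -> : b_poly j.+2 0 =
  b_poly j.+1 0 + (1 - 'X^(j.+2)) * b_poly j.+1 0 - b_poly j 0 by [].
by rewrite IH0 IH1 mulr0 !addr0 subr0.
Qed.

Lemma b_poly_gt j k : (j < k)%N -> b_poly j k = 0.
Proof.
suff: (forall k, (j < k)%N -> b_poly j k = 0) /\
      (forall k, (j.+1 < k)%N -> b_poly j.+1 k = 0) by case=> + _; apply.
elim: j => {k}[|j [IH0 IH1]]; first by split=> // -[|[|k]].
split=> // -[|[|[|k]]] // lt_jk.
have ne_kj : (k.+3 == j.+2) = false by apply/negbTE; lia.
have -> : b_poly j.+2 k.+3 =
  b_poly j.+1 k.+2 + (1 - 'X^(j.+2)) * b_poly j.+1 k.+3 - b_poly j k.+2.
  by rewrite [LHS]/= ne_kj.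
by rewrite !IH1 ?IH0 ?mulr0 ?addr0 ?subr0 //; lia.
Qed.

Local Arguments b_poly : simpl never.

(** With b_j^0 = 0 and b_j^k = 0 for k > j, the recurrence that defines b also
covers the first column and the diagonal. *)
Lemma b_poly_pascal j k :
  b_poly j.+2 k.+1 =
    b_poly j.+1 k + (1 - 'X^(j.+2)) * b_poly j.+1 k.+1 - b_poly j k.
Proof.
have [lt_jk|] := ltnP j.+1 k.
  by rewrite !b_poly_gt ?mulr0 ?addr0 ?subr0 //; lia.
rewrite leq_eqVlt => /predU1P[->|]; last rewrite ltnS leq_eqVlt => /predU1P[->|].
- by rewrite !b_poly_diag // !b_poly_gt // mulr0 addr0 subr0.
- case: j => [|j].
    by rewrite !b_poly0 b_poly_1 // b_poly_diag // big_nat1 mulr1 add0r subr0.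
  by rewrite b_poly_rec //=; lia.
case: k => [_|k lt_kj].
  rewrite !b_poly0 subr0 add0r b_poly_1 // big_nat_recr // [RHS]mulrC.
  congr (_ * _); case: j => [|j]; last by rewrite b_poly_1.
  by rewrite big_geq // b_poly_diag.
by rewrite b_poly_rec //=; lia.
Qed.

(** The row j of b applied to the vector of the A_(k+d), that is, to the
sequence q^(k+1) a_(k-1) shifted by d; k is shifted by one. *)
Definition weighted_row (d j : nat) : {poly int} :=
  \sum_(0 <= k < j) b_poly j k.+1 * ('X^(k + d + 2) * normal_poly (k + d) (k + d)).

(** The terms b_(j-1)^(k-1) and b_(j-2)^(k-1) of the recurrence turn the shift d
into d + 1. *)
Lemma weighted_rowS d j :
  weighted_row d j.+2 = weighted_row d.+1 j.+1 - weighted_row d.+1 j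
    + (1 - 'X^(j.+2)) * weighted_row d j.+1.
Proof.
pose a k := 'X^(k + d + 2) * normal_poly (k + d) (k + d).
have rowS m : weighted_row d.+1 m = \sum_(0 <= k < m) b_poly m k.+1 * a k.+1.
  by apply: eq_bigr => k _; rewrite /a addSnnS.
have shift m N : (m <= N)%N ->
    \sum_(0 <= k < N.+1) b_poly m k * a k = \sum_(0 <= k < m) b_poly m k.+1 * a k.+1.
  move=> le_mN; rewrite big_nat_recl // b_poly0 mul0r add0r.
  rewrite (big_cat_nat _ le_mN) //= [X in _ + X]big1_seq ?addr0 // => k.
  by rewrite mem_index_iota => /= /andP[le_mk _]; rewrite b_poly_gt ?mul0r.
rewrite !rowS -(shift j.+1 j.+1) // -(shift j j.+1) // -sumrB.
have -> : weighted_row d j.+1 = \sum_(0 <= k < j.+2) b_poly j.+1 k.+1 * a k.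
  by rewrite [RHS]big_nat_recr // b_poly_gt // mul0r /= addr0.
rewrite big_distrr -big_split; apply: eq_bigr => k _ /=.
by rewrite b_poly_pascal -/(a k); ring.
Qed.

(** The two terms of shift d + 1 given by [weighted_rowS] differ by the last
summand, a multiple of g(d + 1 + j, d + 1), and removing the last run from the
normal words counted there produces the sum of shift d again. *)
Lemma weighted_rowE d j :
  weighted_row d j = 'X^(d + 2) * \sum_(0 <= t < j) 'X^t * normal_poly (d + t) d.
Proof.
suff: (forall d, weighted_row d j =
        'X^(d + 2) * \sum_(0 <= t < j) 'X^t * normal_poly (d + t) d) /\
      (forall d, weighted_row d j.+1 =
        'X^(d + 2) * \sum_(0 <= t < j.+1) 'X^t * normal_poly (d + t) d) by case.
elim: j => {d}[|j [IH0 IH1]].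
  split=> d; rewrite /weighted_row; first by rewrite !big_geq ?mulr0.
  by rewrite !big_nat1 b_poly_diag // !add0n addn0 expr0 !mul1r.
split=> // d; rewrite weighted_rowS !IH1 IH0 [in RHS]big_nat_recr //=.
rewrite [X in 'X^(d.+1 + 2) * X - _]big_nat_recr //=.
rewrite -addSnnS normal_polyS.
rewrite (_ : (d.+1 + j - d = j.+1)%N); last by lia.
rewrite [in normal_poly (d.+1 + j) d]addSnnS.
have -> : \sum_(0 <= t < j.+1) 'X^(t.+1) * normal_poly (d + t) d
   = 'X * \sum_(0 <= t < j.+1) 'X^t * normal_poly (d + t) d.
  by rewrite big_distrr /=; apply: eq_bigr => t _; rewrite exprS mulrA.
move: (\sum_(0 <= t < j.+1) _) (\sum_(0 <= t < j) _) (normal_poly _ _) => s r g.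
rewrite addn1 addn2 !exprS; move: ('X^j) ('X^d) => y z; ring.
Qed.

(** The unknowns A_k = q^(k+1) a_(k-1) of the triangular system; the value at 0
allows sums over all k < j. *)
Definition scaled_normal_poly (k : nat) : {poly int} :=
  if k is k1.+1 then 'X^(k1 + 2) * normal_poly k1 k1 else 0.

Lemma b_poly_scaled_normal_poly j :
  \sum_(0 <= k < j.+1) b_poly j k * scaled_normal_poly k = \sum_(2 <= m < j.+2) 'X^m.
Proof.
rewrite big_nat_recl //= mulr0 add0r.
have -> : \sum_(0 <= k < j) b_poly j k.+1 * ('X^(k + 2) * normal_poly k k) =
          weighted_row 0 j by apply: eq_bigr => k _; rewrite addn0.
rewrite weighted_rowE big_distrr !big_add1 /=; apply: eq_bigr => t _.
by rewrite normal_poly0 mulr1 -exprD.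
Qed.

(** The entry (a, i) of the k-th power of the strictly triangular part of b. *)
Fixpoint chain_weight (k a i : nat) : {poly int} :=
  if k is k1.+1 then \sum_(0 <= v < a) b_poly a v * chain_weight k1 v i
  else (a == i)%:R.

Lemma chain_weight_small k a i : (a < k + i)%N -> chain_weight k a i = 0.
Proof.
elim: k a => [|k IHk] a /= lt_a; first by case: eqP => // ?; lia.
rewrite big1_seq // => v; rewrite mem_index_iota => /= lt_va.
by rewrite IHk ?mulr0 //; lia.
Qed.

Lemma big_tuple_cons B k (P : pred (seq 'I_B)) (F : seq 'I_B -> {poly int}) :
  \sum_(v : k.+1.-tuple 'I_B | P v) F v =
    \sum_(x : 'I_B) \sum_(t : k.-tuple 'I_B | P (x :: t)) F (x :: t).
Proof.
rewrite pair_big_dep /= (reindex (fun p => cons_tuple p.1 p.2)) //=.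
exists (fun v => (thead v, behead_tuple v)) => [[x t]|v] _ /=.
  by congr (_, _); apply: val_inj.
by rewrite [RHS]tuple_eta; apply: val_inj.
Qed.

(** The bound B on the entries is fixed while a varies, so that the first entry
of a tuple can be removed without changing the type of the others. *)
Lemma tuple_chain_weight B k a i : (a < B)%N ->
  \sum_(v : k.+1.-tuple 'I_B | descending_from_to a i (map val v))
    \prod_(0 <= u < k) b_poly (nth 0%N (map val v) u) (nth 0%N (map val v) u.+1)
  = chain_weight k a i.
Proof.
move=> lt_aB; rewrite (@big_tuple_cons _ _ (fun v => descending_from_to a i (map val v))
  (fun v => \prod_(0 <= u < k)
     b_poly (nth 0%N (map val v) u) (nth 0%N (map val v) u.+1))).
rewrite (bigD1 (Ordinal lt_aB)) //= [X in _ + X]big1 ?addr0; last first.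
  move=> x; rewrite -val_eqE /= => /negPf ne_xa; rewrite big1 // => t.
  by rewrite /descending_from_to /= ne_xa.
elim: k a lt_aB => [|k IHk] a lt_aB /=.
  rewrite big_mkcond (big_pred1 [tuple]) => [|t]; last exact/esym/eqP/tuple0.
  by rewrite /descending_from_to /= eqxx andbT big_geq //; case: eqP.
rewrite (@big_tuple_cons _ _
  (fun v => descending_from_to a i (map val (Ordinal lt_aB :: v)))
  (fun v => \prod_(0 <= u < k.+1) b_poly (nth 0%N (map val (Ordinal lt_aB :: v)) u)
     (nth 0%N (map val (Ordinal lt_aB :: v)) u.+1))).
rewrite big_mkord (big_ord_widen B (fun v => b_poly a v * chain_weight k v i)) 1?ltnW //.
rewrite [RHS]big_mkcond; apply: eq_bigr => v _.
have desc_cons t : descending_from_to a i [:: a, val v & t] =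
    (v < a)%N && descending_from_to v i (val v :: t).
  by rewrite /descending_from_to /= !eqxx !andTb andbCA.
case lt_va: (v < a)%N; last by rewrite big1 // => t; rewrite /= desc_cons lt_va.
rewrite -(IHk v (ltn_ord v)) big_distrr; apply: eq_big => [t|t _] /=.
  by rewrite desc_cons lt_va.
by rewrite big_nat_recl.
Qed.

Lemma chain_sum_weight a i s : chain_sum a i s = chain_weight s.+1 a i.
Proof. exact: tuple_chain_weight. Qed.

(** With b = 1 + T, substituting A = S - T A repeatedly gives the alternating
sum of the T^k S, which is exact at a as soon as K >= a. *)
Lemma invert_unitriangular (A S : nat -> {poly int}) N K a :
  (forall j, \sum_(0 <= k < j) b_poly j k * A k + A j = S j) ->
  (a <= K)%N -> (a < N)%N ->
  A a = \sum_(0 <= k < K.+1) (-1) ^+ k *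
          \sum_(0 <= i < N) S i * chain_weight k a i.
Proof.
move=> AS; have S0 m : (m < N)%N ->
    \sum_(0 <= i < N) S i * chain_weight 0 m i = S m.
  move=> lt_mN; rewrite big_mkord (bigD1 (Ordinal lt_mN)) //= eqxx mulr1.
  rewrite big1 ?addr0 // => i; rewrite -val_eqE /= eq_sym => /negPf->.
  by rewrite mulr0.
elim: K a => [|K IHK] a le_aK lt_aN.
  move: le_aK lt_aN; rewrite leqn0 => /eqP-> lt_0N.
  by rewrite big_nat1 S0 // expr0 mul1r -AS big_geq // add0r.
rewrite big_nat_recl // expr0 mul1r S0 // -AS.
apply/eqP; rewrite addrAC -{1}[A a]add0r (inj_eq (addIr _)) eq_sym addr_eq0 -sumrN; apply/eqP.
transitivity (\sum_(0 <= v < a) \sum_(0 <= k < K.+1) (-1) ^+ k *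
   \sum_(0 <= i < N) b_poly a v * (S i * chain_weight k v i)).
  apply: eq_big_nat => v /andP[_ lt_va]; rewrite (IHK v); [|lia|lia].
  rewrite big_distrr /=; apply: eq_bigr => k _.
  by rewrite mulrCA; congr (_ * _); rewrite big_distrr.
rewrite exchange_big; apply: eq_bigr => k _ /=.
rewrite -big_distrr /= exprS mulN1r mulNr opprK; congr (_ * _).
rewrite exchange_big; apply: eq_bigr => i _ /=.
by rewrite big_distrr /=; apply: eq_bigr => v _; rewrite mulrCA.
Qed.

Local Arguments chain_weight : simpl never.

Theorem theorem4p2 (n : nat) (hn : (1 <= n)%N) :
  'X^(n + 2) * fc_poincare n =
    \sum_(2 <= m < n.+3) 'X^m
    + \sum_(1 <= i < n.+1)
        (\sum_(2 <= m < i.+2) 'X^m)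
        * \sum_(0 <= s < (n - i).+1) (-1) ^+ s.+1 * chain_sum n.+1 i s.
Proof.
pose S i : {poly int} := \sum_(2 <= m < i.+2) 'X^m.
rewrite fc_poincare_normal -[LHS]/(scaled_normal_poly n.+1).
rewrite (@invert_unitriangular scaled_normal_poly S n.+2 n.+1) // => [|[|j]]; last 2 first.
- by rewrite /S !big_geq // addr0.
- by rewrite /S -b_poly_scaled_normal_poly [RHS]big_nat_recr //= b_poly_diag ?mul1r.
(* The power 0 gives the term S (n+1), which stands apart. *)
rewrite big_nat_recl // expr0 mul1r; congr (_ + _).
  rewrite big_nat_recr //= /chain_weight eqxx mulr1 big1_seq ?add0r // => i.
  by rewrite mem_index_iota /= => lt_in; rewrite gtn_eqF ?mulr0.
under eq_bigr do rewrite big_distrr.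
(* No nontrivial sequence goes from n+1 to itself. *)
rewrite exchange_big big_nat_recr //= [X in _ + X = _]big1 ?addr0; last first.
  by move=> s _; rewrite (@chain_weight_small s.+1) ?mulr0 //; lia.
(* S 0 is an empty sum. *)
rewrite big_ltn // [X in X + _ = _]big1 ?add0r; last first.
  by move=> s _; rewrite /S [X in _ * (X * _)]big_geq // mul0r mulr0.
apply: eq_big_nat => i /andP[lt_0i lt_in]; rewrite -/(S i) big_distrr /=.
(* A strictly decreasing sequence from n+1 to i has at most n - i inner terms. *)
rewrite (@big_cat_nat _ _ _ (n - i).+1) //=; last by lia.
rewrite [X in _ + X]big1_seq ?addr0 => [|s]; last first.
  rewrite mem_index_iota => /= lt_s.
  by rewrite (@chain_weight_small s.+1) ?mulr0 //; lia.
by apply: eq_bigr => s _; rewrite chain_sum_weight mulrCA.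
Qed.
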